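(* Let $P$ be a normal logic program that is uni-rule, i.e., every atom of $\mathrm{HB}(P)$ is the head of at most one rule of $\mathrm{gr}(P)$. Then $P$ has at least one L-stable model.
   Context: Fix a first-order language with finitely many constant, function and predicate symbols. A normal logic program (NLP) $P$ is a finite set of rules $p \leftarrow p_1,\dots,p_m, \mathord{\sim} p_{m+1},\dots,\mathord{\sim} p_k$ ($k\ge m\ge 0$). $\mathrm{HB}(P)$ is its Herbrand base (possibly infinite), $\mathrm{gr}(P)$ its ground instantiation; for a ground rule $r$: head $\mathrm{head}(r)$, positive/negative body atoms $B^+(r)$, $B^-(r)$, $\mathrm{bf}(r)=\bigwedge_{v\in B^+(r)}v\wedge\bigwedge_{v\in B^-(r)}\neg v$. A three-valued interpretation is a map $I:\mathrm{HB}(P)\to\{0,1,\star\}$; $I^{\mathbf{u}}=\{a: I(a)=\star\}$. Order $\le_t$: $0<_t\star<_t1$; Kleene evaluation ($\neg\star=\star$, $\wedge$ = $\le_t$-min). $I$ is a three-valued model of a program if $I(\mathrm{bf}(r))\le_t I(\mathrm{head}(r))$ for each ground rule. The reduct $P^I$: from $\mathrm{gr}(P)$ delete every rule with some $b\in B^-(r)$, $I(b)=1$; delete each $\mathord{\sim}b$ with $I(b)=0$; replace each remaining $\mathord{\sim}b$ by a special atom $\mathbf{u}$ always valued $\star$. $P^I$ has a unique $\le_t$-least three-valued model; $I$ is a stable partial model if it equals it. $I$ is an L-stable model if it is a stable partial model and there is no stable partial model $J$ with $J^{\mathbf{u}}\subsetneq I^{\mathbf{u}}$. *)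

(* Defs.v *)
From HB Require Import structures.
From mathcomp Require Import all_boot finmap.
From mathcomp Require Import boolp classical_sets.

Set Implicit Arguments.
Unset Strict Implicit.
Unset Printing Implicit Defensive.

Local Open Scope fset_scope.
Local Open Scope classical_set_scope.

Record language := Language {
  lconst : finType;
  lfun : finType;
  lfun_ar : lfun -> nat;
  lpred : finType;
  lpred_ar : lpred -> nat
}.

(* Terms and atoms are parameterized by the type V of variables: V = nat gives
   the terms and atoms of the language, V = void the ground ones. *)
Inductive term (L : language) (V : Type) : Type :=
| Var of V
| Cst of lconst L
| App (f : lfun L) of {ffun 'I_(lfun_ar f) -> term L V}.

Arguments Var {L V}.
Arguments Cst {L V}.
Arguments App {L V} f.

Record atom (L : language) (V : Type) : Type := Atom {
  apred : lpred L;
  aargs : {ffun 'I_(lpred_ar apred) -> term L V}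
}.

Arguments Atom {L V} apred aargs.

Fixpoint tsubst (L : language) (V W : Type) (s : V -> term L W)
    (t : term L V) : term L W :=
  match t with
  | Var x => s x
  | Cst c => Cst c
  | App f ts => App f [ffun i => tsubst s (ts i)]
  end.

Definition asubst (L : language) (V W : Type) (s : V -> term L W)
    (a : atom L V) : atom L W :=
  Atom (apred a) [ffun i => tsubst s (aargs a i)].

HB.instance Definition _ (L : language) (V : Type) := gen_eqMixin (atom L V).
HB.instance Definition _ (L : language) (V : Type) :=
  gen_choiceMixin (atom L V).

(* The Herbrand base: all ground atoms of the language. *)
Definition herbrand_base (L : language) := atom L void.

(* rhead <- pbody, ~ nbody.  The type A of atoms is (atom L nat) for program
   rules, (herbrand_base L) for ground rules, and (option (herbrand_base L)) for
   the rules of a reduct, where None stands for the special atom u. *)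
Record rule (A : choiceType) : Type := Rule {
  rhead : A;
  pbody : {fset A};
  nbody : {fset A}
}.

HB.instance Definition _ (A : choiceType) := gen_eqMixin (rule A).
HB.instance Definition _ (A : choiceType) := gen_choiceMixin (rule A).

Definition rule_map (A B : choiceType) (f : A -> B) (r : rule A) : rule B :=
  Rule (f (rhead r)) [fset f a | a in pbody r] [fset f a | a in nbody r].

Definition nlp (L : language) := {fset rule (atom L nat)}.

Definition atom_of_ground (L : language) : herbrand_base L -> atom L nat :=
  asubst (fun v : void => of_void (term L nat) v).

(* g is a ground rule which, seen as a rule with variables, is an instance of a
   rule of P.  Substitutions take values in all terms rather than in ground
   terms, so that variable-free rules are their own ground instance even when
   the language has no constant, hence no ground term. *)
Definition gr (L : language) (P : nlp L) : set (rule (herbrand_base L)) :=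
  [set g | exists2 r, r \in P & exists s : nat -> term L nat,
    rule_map (@atom_of_ground L) g = rule_map (asubst s) r].

Inductive tv : Type := tv0 | tvstar | tv1.

Definition tv_rank (x : tv) : nat :=
  match x with tv0 => 0 | tvstar => 1 | tv1 => 2 end.

Definition tv_le (x y : tv) : bool := tv_rank x <= tv_rank y.

Definition tv_neg (x : tv) : tv :=
  match x with tv0 => tv1 | tvstar => tvstar | tv1 => tv0 end.

Definition tv_and (x y : tv) : tv := if tv_le x y then x else y.

Definition bf_eval (A : choiceType) (I : A -> tv) (r : rule A) : tv :=
  tv_and (\big[tv_and/tv1]_(v <- pbody r) I v)
         (\big[tv_and/tv1]_(v <- nbody r) tv_neg (I v)).

Definition model (A : choiceType) (G : set (rule A)) (I : A -> tv) : Prop :=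
  forall r, G r -> tv_le (bf_eval I r) (I (rhead r)).

Definition interp_le (A : Type) (I J : A -> tv) : Prop :=
  forall a, tv_le (I a) (J a).

Definition undef (A : Type) (I : A -> tv) : set A := [set a | I a = tvstar].

Definition with_u (A : Type) (I : A -> tv) (x : option A) : tv :=
  if x is Some a then I a else tvstar.

(* Once the rules with a negative body atom of value 1 are deleted, every
   negative literal whose atom is not of value 0 is replaced by u. *)
Definition reduct (L : language) (P : nlp L) (I : herbrand_base L -> tv) :
    set (rule (option (herbrand_base L))) :=
  [set q | exists2 r, gr P r & (forall b, b \in nbody r -> I b <> tv1) /\
    q = Rule (Some (rhead r))
          ([fset Some v | v in pbody r] `|`
           [fset None | b in nbody r & `[< I b <> tv0 >]])%fset
          fset0].

Definition least_model_of_reduct (L : language) (P : nlp L)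
    (I M : herbrand_base L -> tv) : Prop :=
  model (reduct P I) (with_u M) /\
  forall N : herbrand_base L -> tv,
    model (reduct P I) (with_u N) -> interp_le M N.

Definition stable_partial_model (L : language) (P : nlp L)
    (I : herbrand_base L -> tv) : Prop :=
  least_model_of_reduct P I I.

Definition L_stable_model (L : language) (P : nlp L)
    (I : herbrand_base L -> tv) : Prop :=
  stable_partial_model P I /\
  ~ exists2 J : herbrand_base L -> tv,
      stable_partial_model P J & undef J `<` undef I.

Definition uni_rule (L : language) (P : nlp L) : Prop :=
  forall r1 r2, gr P r1 -> gr P r2 -> rhead r1 = rhead r2 -> r1 = r2.

(* Main.v *)
(** When every atom heads at most one ground rule, an atom whose positive
    dependency tree is not well founded is false in every stable partial model.
    So the stable partial models are exactly the interpretations that are false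
    on these fixed atoms and satisfy the completion equation I(head) = I(body)
    on the others.  As bodies are finite, these conditions are closed in the
    product topology, hence by compactness (ultrafilter limits) Zorn's lemma
    yields a maximal set of defined atoms.  A first solution is the
    well-founded model, the least fixpoint for the knowledge order. *)
Require Import Defs.
From mathcomp Require Import all_boot finmap.
From mathcomp Require Import boolp classical_sets filter.

Set Implicit Arguments.
Unset Strict Implicit.
Unset Printing Implicit Defensive.

Local Open Scope classical_set_scope.

(** * Truth order and Kleene evaluation of bodies *)

Lemma tv_le_refl x : tv_le x x.
Proof. by case: x. Qed.

Lemma tv_le_trans y x z : tv_le x y -> tv_le y z -> tv_le x z.
Proof. exact: leq_trans. Qed.

Lemma tv_le1 x : tv_le x tv1.
Proof. by case: x. Qed.

(** Identifies a body value through its lower bounds, which [tv_le_bf] describes literal by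
    literal. *)
Lemma tv_le_eq x y : (forall z, tv_le z x <-> tv_le z y) -> x = y.
Proof.
move=> xy; have := (xy x).1 (tv_le_refl x); have := (xy y).2 (tv_le_refl y).
by case: x {xy}; case: y.
Qed.

Lemma tv_le_and x y z : tv_le x (tv_and y z) = tv_le x y && tv_le x z.
Proof. by case: x; case: y; case: z. Qed.

Lemma tv_le_big (A : choiceType) (s : seq A) (f : A -> tv) x :
  tv_le x (\big[tv_and/tv1]_(v <- s) f v) <->
  forall v, v \in s -> tv_le x (f v).
Proof.
elim: s => [|a s IH]; first by rewrite big_nil tv_le1.
rewrite big_cons tv_le_and; split.
- by move=> /andP[xa /IH xs] v; rewrite inE => /predU1P[->|/xs].
- move=> xs; rewrite xs ?mem_head //; apply/IH => v vs.
  by apply: xs; rewrite inE vs orbT.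
Qed.

Lemma tv_le_bf (A : choiceType) (I : A -> tv) (r : rule A) x :
  tv_le x (bf_eval I r) <->
  (forall v, v \in pbody r -> tv_le x (I v)) /\
  (forall v, v \in nbody r -> tv_le x (tv_neg (I v))).
Proof.
rewrite /bf_eval tv_le_and; split.
- by move=> /andP[/tv_le_big ? /tv_le_big ?].
- by move=> [? ?]; apply/andP; split; apply/tv_le_big.
Qed.

Lemma eq_bf_eval (A : choiceType) (I J : A -> tv) (r : rule A) :
  (forall v, v \in (pbody r `|` nbody r)%fset -> I v = J v) ->
  bf_eval I r = bf_eval J r.
Proof.
move=> IJ; congr tv_and; apply: eq_big_seq => v vr;
  by rewrite IJ // in_fsetE vr ?orbT.
Qed.

Lemma bf_eval_pbody0 (A : choiceType) (I : A -> tv) (r : rule A) v :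
  v \in pbody r -> I v = tv0 -> bf_eval I r = tv0.
Proof.
move=> vr Iv; have := ((tv_le_bf I r _).1 (tv_le_refl _)).1 _ vr.
by rewrite Iv; case: bf_eval.
Qed.

Lemma bf_eval_nbody1 (A : choiceType) (I : A -> tv) (r : rule A) v :
  v \in nbody r -> I v = tv1 -> bf_eval I r = tv0.
Proof.
move=> vr Iv; have := ((tv_le_bf I r _).1 (tv_le_refl _)).2 _ vr.
by rewrite Iv; case: bf_eval.
Qed.

(** * Founded atoms, completion models, well-founded model *)

Inductive founded (A : choiceType) (G : set (rule A)) : A -> Prop :=
| Founded r : G r -> (forall v, v \in pbody r -> founded G v) ->
    founded G (rhead r).

(** Clark completion, with a first clause that keeps [p <- p] from making [p] true. Atoms heading no
    rule are unfounded, so this clause covers them. *)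
Definition completion_model (A : choiceType) (G : set (rule A)) (I : A -> tv) :=
  (forall a, ~ founded G a -> I a = tv0) /\
  (forall r, G r -> founded G (rhead r) -> I (rhead r) = bf_eval I r).

(* The atoms that are true (b = true) or false (b = false) in the well-founded
   model. *)
Inductive decided (A : choiceType) (G : set (rule A)) : bool -> A -> Prop :=
| DecidedTrue r : G r -> founded G (rhead r) ->
    (forall v, v \in pbody r -> decided G true v) ->
    (forall v, v \in nbody r -> decided G false v) ->
    decided G true (rhead r)
| DecidedUnfounded a : ~ founded G a -> decided G false a
| DecidedPbody r v : G r -> v \in pbody r -> decided G false v ->
    decided G false (rhead r)
| DecidedNbody r v : G r -> v \in nbody r -> decided G true v ->
    decided G false (rhead r).

Definition unique_heads (A : choiceType) (G : set (rule A)) :=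
  forall r1 r2, G r1 -> G r2 -> rhead r1 = rhead r2 -> r1 = r2.

Lemma not_founded_pbody (A : choiceType) (G : set (rule A)) (r : rule A) :
  G r -> ~ founded G (rhead r) -> exists2 v, v \in pbody r & ~ founded G v.
Proof.
move=> Gr nf; apply: contrapT => h; apply: nf; apply: Founded => // v vr.
by apply: contrapT => nfv; apply: h; exists v.
Qed.

Lemma completion_model_model (A : choiceType) (G : set (rule A)) (I : A -> tv) :
  completion_model G I -> model G I.
Proof.
move=> [I0 IG] r Gr; have [f|nf] := pselect (founded G (rhead r)).
  by rewrite IG // tv_le_refl.
have [v vr nfv] := not_founded_pbody Gr nf.
by rewrite (bf_eval_pbody0 vr) ?I0.
Qed.

(** Induction on one derivation: heads being unique, the opposite one uses the same rule, so the
    conflict passes to a body atom or contradicts foundedness. *)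
Lemma decided_consistent (A : choiceType) (G : set (rule A)) b a :
  unique_heads G -> decided G b a -> ~ decided G (~~ b) a.
Proof.
move=> uG; elim=> {b a} [r Gr fr _ IHp _ IHn|a nfa|r v Gr vr _ IH|r v Gr vr _ IH]
  /= D; inversion D as [r' Gr' fr' Dp Dn eb e'|a' nfa' e|r' v' Gr' vr' Dv eb e'
                        |r' v' Gr' vr' Dv eb e'] => //.
- by rewrite (uG _ _ Gr' Gr e') in vr'; apply: IHp vr' Dv.
- by rewrite (uG _ _ Gr' Gr e') in vr'; apply: IHn vr' Dv.
- by apply: nfa; rewrite -e'.
- by apply: IH; apply: Dp; rewrite (uG _ _ Gr' Gr e').
- by apply: IH; apply: Dn; rewrite (uG _ _ Gr' Gr e').
Qed.

(** Take the well-founded model, [tvstar] on undecided atoms. Inverting [decided] at the unique rule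
    of a head gives the equation, threshold by threshold. *)
Lemma exists_completion_model (A : choiceType) (G : set (rule A)) :
  unique_heads G -> exists I, completion_model G I.
Proof.
move=> uG; pose I a := if `[< decided G true a >] then tv1
  else if `[< decided G false a >] then tv0 else tvstar.
have I1 a : tv_le tv1 (I a) <-> decided G true a.
  by rewrite /I; case: asboolP => // ?; case: asboolP.
(* By consistency, testing [decided G true] first in [I] hides no false atom. *)
have Is a : tv_le tvstar (I a) <-> ~ decided G false a.
  rewrite /I; case: asboolP => [Dt|_]; last by case: asboolP.
  by split=> // _; exact: decided_consistent uG Dt.
have N1 a : tv_le tv1 (tv_neg (I a)) <-> decided G false a.
  by rewrite -[decided _ _ _]not_notE -Is; case: (I a) => /=; split.
have Ns a : tv_le tvstar (tv_neg (I a)) <-> ~ decided G true a.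
  by rewrite -I1; case: (I a) => /=; split.
exists I; split=> [a nf|r Gr fr].
  have: ~ tv_le tvstar (I a) by rewrite Is; apply; exact: DecidedUnfounded.
  by case: (I a).
apply: tv_le_eq => z; rewrite tv_le_bf; case: z; first by [].
- rewrite Is; split=> [nD|[pr nr] D].
    split=> v vr; first by apply/Is => D; apply: nD; exact: DecidedPbody vr D.
    by apply/Ns => D; apply: nD; exact: DecidedNbody vr D.
  inversion D as [|a nf|r' v Gr' vr Dv eb e|r' v Gr' vr Dv eb e] => //.
    by rewrite (uG _ _ Gr' Gr e) in vr; have /Is := pr _ vr.
  by rewrite (uG _ _ Gr' Gr e) in vr; have /Ns := nr _ vr.
- rewrite I1; split=> [D|[pr nr]].
    inversion D as [r' Gr' fr' Dp Dn eb e| | |].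
    rewrite (uG _ _ Gr' Gr e) in Dp Dn.
    by split=> v vr; [apply/I1/Dp | apply/N1/Dn].
  by apply: DecidedTrue => // v vr; [apply/I1/pr | apply/N1/nr].
Qed.

(** * Compactness and maximality *)

Lemma ultrafilter_limit (A : Type) (U : set_system (A -> tv)) :
  UltraFilter U -> exists J : A -> tv, forall a, U [set I | I a = J a].
Proof.
move=> UU; suff /choice[J JU] : forall a, exists x, U [set I | I a = x].
  by exists J.
(* Missing the fibres over [tv0] and [tv1], an ultrafilter contains their complements, hence the
   fibre over [tvstar]. *)
move=> a; have [U0|U0] := in_ultra_setVsetC [set I : A -> tv | I a = tv0] UU.
  by exists tv0.
have [U1|U1] := in_ultra_setVsetC [set I : A -> tv | I a = tv1] UU.
  by exists tv1.
by exists tvstar; apply: filterS2 U0 U1 => I /=; case: (I a).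
Qed.

Lemma completion_model_limit (A : choiceType) (G : set (rule A))
    (U : set_system (A -> tv)) (J : A -> tv) :
  ProperFilter U -> (forall a, U [set I | I a = J a]) ->
  U (completion_model G) -> completion_model G J.
Proof.
move=> FU UJ UG; split=> [a nf|r Gr fr].
  by have [I [[I0 _] <-]] := filter_ex (filterI UG (UJ a)); exact: I0.
(* The body being finite, one completion model agrees with [J] on head and body at once. *)
have Ubody := filter_bigI FU
  (fun v (_ : v \in (pbody r `|` nbody r)%fset) => UJ v).
have [I [[[_ IG] IJh] IJ]] :=
  filter_ex (filterI (filterI UG (UJ (rhead r))) Ubody).
by rewrite -IJh IG //; apply: eq_bf_eval => v vr; exact: IJ.
Qed.

Lemma maximal_completion_model (A : choiceType) (G : set (rule A)) :
  unique_heads G ->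
  exists2 I, completion_model G I &
    ~ exists2 J, completion_model G J & undef J `<` undef I.
Proof.
(* Zorn runs over sets of atoms: the models witnessing the members of a chain need not be
   related. *)
move=> uG; pose defines D := completion_model G `&`
  [set I | D `<=` ~` undef I].
have [F FP totF|D [[I [IG DI]] maxD]] := @Zorn_bigcup A [set D | defines D !=set0].
  have [->|/set0P F0] := eqVneq F set0.
    rewrite bigcup_set0; have [I IG] := exists_completion_model uG.
    by exists I; split=> //; exact: sub0set.
  (* A larger [D] leaves fewer models, so a nonempty chain yields a filter base. *)
  have FF : Filter (filter_from F defines).
    apply: filter_from_filter => // D E FD FE.
    have [DE|ED] := totF _ _ FD FE; [exists E | exists D] => // I [IG IE];
      by split; split=> //; apply: subset_trans IE.
  have PF : ProperFilter (filter_from F defines).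
    by apply: filter_from_proper => D /FP.
  have [U [UU FU]] := ultraFilterLemma PF.
  have [J UJ] := ultrafilter_limit UU.
  exists J; split.
    have [D FD] := F0; apply: completion_model_limit UJ _; apply: FU.
    by exists D => // I [].
  move=> a [D FD Da] Ja.
  have UD : U (defines D) by apply: FU; exists D.
  have [I [[_ ID] IJ]] := filter_ex (filterI UD (UJ a)).
  by apply: (ID a Da); rewrite /undef /= IJ.
(* Such a [J] would make the complement of [undef J] a candidate strictly larger than [D]. *)
exists I => // -[J JG [JI nIJ]]; apply: (maxD (~` undef J)); last by exists J; split.
split=> [a /DI Ia /JI|sJD]; [exact: Ia|apply: nIJ => a Ia; apply: contrapT => Ja].
exact: (DI a (sJD a Ja)).
Qed.

(** * Stable partial models as completion models *)

Definition reduct_rule (A : choiceType) (I : A -> tv) (r : rule A) :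
    rule (option A) :=
  Rule (Some (rhead r))
    ([fset Some v | v in pbody r] `|`
     [fset None | b in nbody r & `[< I b <> tv0 >]])%fset fset0.

(** The reduct freezes negative literals at their value in [I]: those of value [tv1] are dropped,
    those of value [tvstar] become [None]. *)
Lemma tv_le_bf_reduct (A : choiceType) (I N : A -> tv) (r : rule A) x :
  (forall b, b \in nbody r -> I b <> tv1) ->
  tv_le x (bf_eval (with_u N) (reduct_rule I r)) <->
  (forall v, v \in pbody r -> tv_le x (N v)) /\
  (forall v, v \in nbody r -> tv_le x (tv_neg (I v))).
Proof.
move=> n1; rewrite tv_le_bf /=; split=> [[pr _]|[pr nr]].
  split=> v vr.
    by apply: (pr (Some v)); rewrite in_fsetE in_imfset.
  case Iv: (I v) => /=; [exact: tv_le1| |by have := n1 v vr].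
  apply: (pr None); rewrite in_fsetE; apply/orP; right.
  by apply/imfsetP; exists v => //=; rewrite !inE vr; apply/asboolP; rewrite Iv.
split=> // v; rewrite in_fsetE => /orP[/imfsetP[w /= wr ->]|]; first exact: pr.
move=> /imfsetP[w /=]; rewrite !inE => /andP[wr /asboolP Iw] ->.
by have := nr _ wr; have := n1 _ wr; case: (I w) Iw.
Qed.

Lemma bf_reduct (A : choiceType) (I : A -> tv) (r : rule A) :
  (forall b, b \in nbody r -> I b <> tv1) ->
  bf_eval (with_u I) (reduct_rule I r) = bf_eval I r.
Proof.
by move=> n1; apply: tv_le_eq => z; rewrite tv_le_bf_reduct // tv_le_bf.
Qed.

Lemma model_reduct (L : language) (P : nlp L) (I N : herbrand_base L -> tv) :
  model (reduct P I) (with_u N) <->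
  forall r, gr P r -> (forall b, b \in nbody r -> I b <> tv1) ->
    tv_le (bf_eval (with_u N) (reduct_rule I r)) (N (rhead r)).
Proof.
split=> [mN r Gr n1|mN _ [r Gr [n1 ->]]]; last exact: mN.
by apply: (mN (reduct_rule I r)); exists r.
Qed.

(** A deleted rule has body value [tv0] under [I], so it constrains nothing. *)
Lemma model_reduct_self (L : language) (P : nlp L) (I : herbrand_base L -> tv) :
  model (reduct P I) (with_u I) <-> model (gr P) I.
Proof.
rewrite model_reduct; split=> [mI r Gr|mI r Gr n1]; last first.
  by rewrite bf_reduct //; exact: mI.
have [n1|/existsNP[b /not_implyP[br /contrapT Ib]]] :=
  pselect (forall b, b \in nbody r -> I b <> tv1); last first.
  by rewrite (bf_eval_nbody1 br Ib).
by rewrite -bf_reduct //; exact: mI.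
Qed.

(** Leastness is by induction on foundedness: from [I] to [N] the positive body atoms grow, while
    the negative literals are frozen. *)
Lemma completion_model_stable (L : language) (P : nlp L)
    (I : herbrand_base L -> tv) :
  completion_model (gr P) I -> stable_partial_model P I.
Proof.
move=> IG; split; first by apply/model_reduct_self/completion_model_model.
move=> N /model_reduct mN a; have [I0 I_bf] := IG.
have [fa|nfa] := pselect (founded (gr P) a); last by rewrite I0.
elim: fa => {a} r Gr fp IH; rewrite I_bf //.
have [n1|/existsNP[b /not_implyP[br /contrapT Ib]]] :=
  pselect (forall b, b \in nbody r -> I b <> tv1); last first.
  by rewrite (bf_eval_nbody1 br Ib).
apply: tv_le_trans (mN _ Gr n1); apply/tv_le_bf_reduct => //.
have /tv_le_bf[pr nr] := tv_le_refl (bf_eval I r).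
by split=> // v vr; apply: tv_le_trans (pr _ vr) (IH _ vr).
Qed.

(** Applying the completion equation once to [I] gives an [N] below [I] that still models the
    reduct; leastness forces [I = N]. *)
Lemma stable_completion_model (L : language) (P : nlp L)
    (I : herbrand_base L -> tv) :
  uni_rule P -> stable_partial_model P I -> completion_model (gr P) I.
Proof.
move=> uP [/model_reduct_self mI leastI].
have /choice[N HN] a : exists x, (~ founded (gr P) a -> x = tv0) /\
    forall r, gr P r -> rhead r = a -> founded (gr P) a -> x = bf_eval I r.
  have [fa|nfa] := pselect (founded (gr P) a); last by exists tv0.
  case: fa => r Gr fp; exists (bf_eval I r); split=> [nf|r' Gr' r'a _].
    by case: nf; exact: Founded Gr fp.
  by rewrite (uP _ _ Gr' Gr r'a).
have N0 a : ~ founded (gr P) a -> N a = tv0 by exact: (HN a).1.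
have N_bf r : gr P r -> founded (gr P) (rhead r) -> N (rhead r) = bf_eval I r.
  by move=> Gr; exact: (HN (rhead r)).2.
have NI : interp_le N I.
  move=> a; have [fa|/N0 -> //] := pselect (founded (gr P) a).
  case: fa => r Gr fr; rewrite N_bf //; exact: mI.
have mN : model (reduct P I) (with_u N).
  apply/model_reduct => r Gr n1.
  have [fr|nfr] := pselect (founded (gr P) (rhead r)).
    (* As [N] is below [I], the reduct body under [N] is at most the body under [I], which is the
       value of [N] at the head. *)
    rewrite N_bf //; apply/tv_le_bf.
    have := tv_le_refl (bf_eval (with_u N) (reduct_rule I r)).
    move=> /(tv_le_bf_reduct N _ n1)[pr nr].
    by split=> // v vr; exact: tv_le_trans (pr v vr) (NI v).
  have [v vr nfv] := not_founded_pbody Gr nfr.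
  rewrite (@bf_eval_pbody0 _ _ _ (Some v)) //=; last exact: N0.
  by rewrite in_fsetE in_imfset.
have IN a : I a = N a.
  by have := leastI N mN a; have := NI a; case: (I a); case: (N a).
by split=> [a /N0|r Gr /(N_bf r Gr)]; rewrite IN.
Qed.

Lemma stable_partial_modelE (L : language) (P : nlp L) :
  uni_rule P -> stable_partial_model P = completion_model (gr P).
Proof.
move=> uP; apply/funext => I; apply/propext.
by split; [exact: stable_completion_model | exact: completion_model_stable].
Qed.

Theorem theoremC1 (L : language) (P : nlp L) :
  uni_rule P -> exists I : herbrand_base L -> tv, L_stable_model P I.
Proof.
(* [uni_rule P] unfolds to [unique_heads (gr P)]. *)
move=> uP; have [I IG maxI] := maximal_completion_model uP.
by exists I; rewrite /L_stable_model stable_partial_modelE.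
Qed.
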